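(* Let $a_1,a_2,a_3,a_4$ be analytic functions of $t$ on a domain in $\mathbb{C}$ and let $$A=\begin{pmatrix} z & a_1 & 1 \\ 1 & -z-t & a_2 \\ a_3 & a_4 & t \end{pmatrix}.$$ Suppose that $\frac{d}{dz}+A$ commutes with an operator $\frac{d}{dt}+B(z,t)$, where $B$ is a matrix polynomial of degree $1$ in $z$ with coefficients depending on $t$. Then (with $'=\frac{d}{dt}$) $$a_1'=-3a_1a_2a_3+3a_4,\qquad a_2'=-\tfrac32a_1a_2^2+3a_2^2a_3-\tfrac92a_2t-\tfrac32,$$ $$a_3'=\tfrac32a_1a_2a_3-\tfrac32a_4,\qquad a_4'=\tfrac32a_1a_2a_4-3a_2a_3a_4+\tfrac32a_1a_3+\tfrac92a_4t.$$ Moreover $p_1:=a_1+2a_3$ and $p_2:=a_1+a_3+a_2a_4$ are constant, and eliminating $a_1,a_3$ gives $$a_2'=-\tfrac32+6a_2^3a_4+\tfrac{9p_1-12p_2}{2}a_2^2-\tfrac{9}{2}a_2t,$$ $$a_4'=\tfrac{3(-p_1+2p_2)(-p_2+p_1)}{2}+\tfrac{9t}{2}a_4+(-9p_1+12p_2)a_2a_4-9a_2^2a_4^2.$$ This is a Hamiltonian system $a_4'=\frac{\partial H}{\partial a_2}$, $a_2'=-\frac{\partial H}{\partial a_4}$ with $$H=-3a_4^2a_2^3-\tfrac{9p_1-12p_2}{2}a_4a_2^2-\tfrac{3p_1^2-9p_1p_2+6p_2^2}{2}a_2+\tfrac32a_4+\tfrac{9a_2a_4}{2}t.$$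
   Context: The operators $\frac{d}{dz}+A$ and $\frac{d}{dt}+B$ commute if and only if $\frac{\partial A}{\partial t}=\frac{\partial B}{\partial z}+[A,B]$ identically in $z$. This is a family of rank 3 connections, regular at $z=0$, with eigenvalues $z^2,-z^2-tz,tz$ at $z=\infty$ (with respect to the derivation $z\frac{d}{dz}$). In the partial derivatives of $H$, the variables $a_2,a_4,t$ are independent and $p_1,p_2$ are constants. *)

(* Defs.v *)
From HB Require Import structures.
From mathcomp Require Import all_boot all_order all_algebra.
From mathcomp Require Import all_classical all_reals all_analysis.
From mathcomp Require Import complex.

Set Implicit Arguments.
Unset Strict Implicit.
Unset Printing Implicit Defensive.

Import Order.TTheory GRing.Theory Num.Theory.
Import numFieldNormedType.Exports.

Local Open Scope classical_set_scope.
Local Open Scope ring_scope.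

(* R[i], bundled as a numClosedFieldType so that the topology and the norm
   which the library attaches to every numeric field are found on it;
   [derive1] at this type is the complex derivative. *)
Definition C (R : realType) : numClosedFieldType := complex R.

Definition domain (R : realType) (U : set (C R)) : Prop :=
  [/\ open U, connected U & U !=set0].

(* Analyticity as complex (Frechet) differentiability at every point; it is
   only used for open D, with V = C or V = C * C. *)
Definition analytic_on (R : realType) (V W : normedModType (C R))
    (D : set V) (f : V -> W) : Prop :=
  forall x, D x -> differentiable f x.

Section Connection.
Variable R : realType.
Implicit Types (z t : C R) (F : C R -> C R -> 'cV[C R]_3).

Definition mx3 (rows : seq (seq (C R))) : 'M[C R]_3 :=
  \matrix_(i < 3, j < 3) nth 0 (nth [::] rows i) j.

Definition connA (a1 a2 a3 a4 : C R -> C R) z t : 'M[C R]_3 :=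
  mx3 [:: [:: z;    a1 t;    1   ];
          [:: 1;    - z - t; a2 t];
          [:: a3 t; a4 t;    t   ]].

(* d/dz + M and d/dt + M, acting on vector functions of (z, t); vectors are
   differentiated entrywise. *)
Definition dz_plus (M : C R -> C R -> 'M[C R]_3) F : C R -> C R -> 'cV[C R]_3 :=
  fun z t => \col_i derive1 (fun s => F s t i 0) z + M z t *m F z t.

Definition dt_plus (M : C R -> C R -> 'M[C R]_3) F : C R -> C R -> 'cV[C R]_3 :=
  fun z t => \col_i derive1 (fun s => F z s i 0) t + M z t *m F z t.

(* For B polynomial in z, all derivatives taken below exist at analytic F
   whenever A is analytic: no regularity of B in t is needed. *)
Definition commute_on (U : set (C R)) (A B : C R -> C R -> 'M[C R]_3) : Prop :=
  forall F,
    (forall i, analytic_on [set x : C R * C R | U x.2]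
                           (fun x => F x.1 x.2 i 0)) ->
  forall z t, U t ->
    dz_plus A (dt_plus B F) z t = dt_plus B (dz_plus A F) z t.

End Connection.

Section Hamiltonian.
Variable R : realType.

Definition a2_field (p1 p2 a2 a4 t : C R) : C R :=
  - (3 / 2) + 6 * a2 ^+ 3 * a4 + (9 * p1 - 12 * p2) / 2 * a2 ^+ 2
  - 9 / 2 * a2 * t.

Definition a4_field (p1 p2 a2 a4 t : C R) : C R :=
  3 * (- p1 + 2 * p2) * (- p2 + p1) / 2 + 9 * t / 2 * a4
  + (- 9 * p1 + 12 * p2) * a2 * a4 - 9 * a2 ^+ 2 * a4 ^+ 2.

Definition hamiltonian (p1 p2 a2 a4 t : C R) : C R :=
  - 3 * a4 ^+ 2 * a2 ^+ 3 - (9 * p1 - 12 * p2) / 2 * a4 * a2 ^+ 2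
  - (3 * p1 ^+ 2 - 9 * p1 * p2 + 6 * p2 ^+ 2) / 2 * a2
  + 3 / 2 * a4 + 9 * a2 * a4 / 2 * t.

Definition dH_da2 (p1 p2 a2 a4 t : C R) : C R :=
  derive1 (fun x : C R => hamiltonian p1 p2 x a4 t) a2.

Definition dH_da4 (p1 p2 a2 a4 t : C R) : C R :=
  derive1 (fun y : C R => hamiltonian p1 p2 a2 y t) a4.

End Hamiltonian.

(* Main.v *)
Require Import Defs.
From HB Require Import structures.
From mathcomp Require Import all_boot all_order all_algebra.
From mathcomp Require Import all_classical all_reals all_analysis.
From mathcomp Require Import complex ring.

Set Implicit Arguments.
Unset Strict Implicit.
Unset Printing Implicit Defensive.

Import Order.TTheory GRing.Theory Num.Theory.
Import numFieldNormedType.Exports.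
Import ComplexField.Normc.

Local Open Scope classical_set_scope.
Local Open Scope ring_scope.

(* Applied to the constant vector functions e_j, commutation gives the
   zero-curvature equation dA/dt = dB/dz + [A, B].  With A = A0 + z A1 and
   B = B0 + z B1, where A1 = diag(1, -1, 0), its z^2 coefficient makes B1
   diagonal, its z coefficient expresses the off-diagonal part of B0 through
   A0 and B1, and the diagonal of its z^0 coefficient gives
   B1 = diag(0, -1, 1).  The six remaining entries are two constraints on the
   diagonal of B0, which is otherwise free, and the four equations for a_i'. *)

(** * Vanishing complex derivative on a domain implies constancy *)

Lemma normcE (R : realType) (z : C R) : `|z| = (normc z)%:C%C :> C R.
Proof. by []. Qed.

(** The norm of [C R] takes its values in [C R]; stating the bound with [normc] makes it available
    to real analysis. *)
Lemma derive1_0_littleo (R : realType) (p : C R -> C R) w :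
  derivable p w 1 -> derive1 p w = 0 ->
  forall e : R, 0 < e -> exists2 d : R, 0 < d &
    forall k : C R, normc k < d -> normc (p (w + k) - p w) <= e * normc k.
Proof.
move=> dp; rewrite derive1E /derive => p0 e e0.
have e0' : (0 : C R) < (e%:C%C : C R) by rewrite ltcR.
move/cvgrPdist_lt: dp => /(_ _ e0').
rewrite p0 /dnbhs => /nbhs_normP [d /= d0 H].
(* A positive element of [C R] is real, so [Re d] is the same radius. *)
exists (complex.Re d).
  by move: d0; rewrite ltcE => /andP[].
move=> k kd.
(* The limit only controls the punctured neighbourhood, so k = 0 is treated apart. *)
have [->|k0] := eqVneq k 0; first by rewrite addr0 subrr normc0 mulr0.
have := H k; rewrite /= sub0r normrN.
have -> : `|k| < d.
  by rewrite ltcE /=; move: d0; rewrite ltcE /= => /andP[-> _].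
move=> /(_ isT k0).
rewrite sub0r normrN normrZ normrV ?unitfE // [k *: 1]mulr1 addrC.
rewrite mulrC ltr_pdivrMr ?normr_gt0 //.
rewrite addrC !normcE -rmorphM ltcR addrC [- p w + _]addrC [k + w]addrC.
exact: ltW.
Qed.

Lemma Re_le_normc (R : rcfType) (z : R[i]) : `|complex.Re z| <= normc z.
Proof. by case: z => a b /=; rewrite -sqrtr_sqr ler_wsqrtr // lerDl sqr_ge0. Qed.

(** The mean value theorem concerns real functions of a real variable, so [p] is restricted to a
    line and a real part is taken. The factor [c] lets the same lemma serve real and imaginary
    parts. *)
Lemma is_derive_Re_line (R : realType) (p : C R -> C R) (c x v : C R) (s : R) :
  derivable p (x + s%:C%C * v) 1 -> derive1 p (x + s%:C%C * v) = 0 ->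
  is_derive s 1 (fun s : R => complex.Re (c * p (x + s%:C%C * v)) : R) 0.
Proof.
move=> dp p0; set g := fun s : R => _.
have H : h^-1 *: ((g \o shift s) h%:A - g s) @[h --> 0^'] --> (0 : R).
  apply/cvgrPdist_le => e e0.
  have N0 (z : C R) : 0 <= normc z by case: z => a b; exact: sqrtr_ge0.
  (* Adding 1 here, and to [normc v] below, keeps the denominators positive when [c] or [v] is
     zero. *)
  pose M := normc c * normc v + 1.
  have M0 : 0 < M by rewrite ltr_wpDl // mulr_ge0.
  have [d d0 Hd] := derive1_0_littleo dp p0 (divr_gt0 e0 M0).
  have V0 : 0 < normc v + 1 by rewrite ltr_wpDl.
  apply/nbhs_normP; exists (d / (normc v + 1)); first exact: divr_gt0.
  move=> h /=; rewrite !sub0r normrN => hd h0.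
  have nh : normc h%:C%C = `|h| by rewrite /= expr0n addr0 sqrtr_sqr.
  rewrite normrN normrM normrV ?unitfE // mulrC ler_pdivrMr ?normr_gt0 //.
  rewrite /g /= [h *: 1]mulr1 -raddfB /= -mulrBr.
  apply: le_trans (Re_le_normc _) _.
  have -> : x + (h + s)%:C%C * v = (x + s%:C%C * v) + h%:C%C * v.
    by rewrite rmorphD /= mulrDl [_ + s%:C%C * v]addrC addrA.
  rewrite normcM.
  have nhv : normc (h%:C%C * v) = `|h| * normc v by rewrite normcM nh.
  have /Hd Hh : normc (h%:C%C * v) < d.
    rewrite nhv; rewrite ltr_pdivlMr // in hd; apply: le_lt_trans hd.
    by rewrite ler_wpM2l // lerDl.
  apply: le_trans (ler_wpM2l (N0 c) Hh) _.
  rewrite nhv.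
  have -> : normc c * (e / M * (`|h| * normc v)) =
      e * `|h| * (normc c * normc v / M) by ring.
  rewrite -[leRHS]mulr1 ler_wpM2l ?mulr_ge0 ?(ltW e0) //.
  by rewrite ler_pdivrMr // mul1r lerDl.
by apply: DeriveDef; [apply/cvg_ex; exists 0 | exact: cvg_lim].
Qed.

(** Balls are convex: the segment from [w] to a nearby [y] stays in [U], and the mean value theorem
    applies to the real part of [c * p] along it. *)
Lemma derive1_0_loc_const (R : realType) (U : set (C R)) (p : C R -> C R) :
  open U ->
  (forall w, U w -> derivable p w 1) -> (forall w, U w -> derive1 p w = 0) ->
  forall w, U w -> \forall y \near w, p y = p w.
Proof.
move=> oU dp p0 w Uw.
have /nbhs_normP [d /= d0 Hd] : nbhs w U by exact: open_nbhs_nbhs.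
apply/nbhs_normP; exists d => // y /= yd.
have key (c : C R) : complex.Re (c * p y) = complex.Re (c * p w).
  pose g (s : R) : R := complex.Re (c * p (w + s%:C%C * (y - w))).
  have inU (s : R) : s \in `[0, 1] -> U (w + s%:C%C * (y - w)).
    rewrite in_itv /= => /andP[s0 s1]; apply: Hd => /=.
    rewrite opprD addNKr normrN normrM.
    apply: le_lt_trans yd; rewrite [leRHS]distrC ler_piMl //.
    by rewrite ger0_norm ?ler0c // lecR.
  have dg (s : R) : s \in `[0, 1] -> is_derive s 1 g 0.
    by move=> /inU Us; apply: is_derive_Re_line; [exact: dp | exact: p0].
  have g1 (s : R) : s \in `]0, 1[ -> is_derive s 1 g 0.
    by move=> s01; apply: dg; exact: subset_itv_oo_cc.
  have g2 : {within `[0, 1], continuous g}.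
    by apply: derivable_within_continuous => s /(dg (s : R)) [].
  have [s _] := @MVT_segment R g (fun=> 0) 0 1 ler01 g1 g2.
  rewrite mul0r /g => /eqP; rewrite subr_eq0 => /eqP.
  by rewrite mul1r mul0r addr0 subrKC.
apply/eqP; rewrite eq_complex; apply/andP; split.
  by have := key 1; rewrite !mul1r => ->.
(* The real part of -i u is the imaginary part of u. *)
have := key (- 'i%C); rewrite !mulNr !raddfN /= ![_ * p _]mulrC.
by rewrite !ReiNIm !opprK => ->.
Qed.

(** Local constancy makes the preimage in [U] of every set open. For {p w0} and its complement, this
    makes the level set of [w0] open and closed relative to [U], hence all of the connected set
    [U]. *)
Lemma derive1_0_domain_const (R : realType) (U : set (C R)) (p : C R -> C R) :
  domain U ->
  (forall w, U w -> derivable p w 1) -> (forall w, U w -> derive1 p w = 0) ->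
  exists c, forall w, U w -> p w = c.
Proof.
move=> [oU cU [w0 Uw0]] dp p0; exists (p w0).
have loc := derive1_0_loc_const oU dp p0.
have opn (P : set (C R)) : open (U `&` p @^-1` P).
  rewrite openE => w [Uw Pw]; rewrite /interior.
  have Uw' : nbhs w U by exact: open_nbhs_nbhs.
  near=> y; split; first by near: y.
  by rewrite /preimage /= (_ : p y = p w) //; near: y; exact: loc.
have E : U `&` p @^-1` [set p w0] = U.
  apply: cU; first by exists w0.
    exists (U `&` p @^-1` [set p w0]); first exact: opn.
    by rewrite setIA setIid.
  exists (~` (U `&` p @^-1` ~` [set p w0])); first exact/open_closedC/opn.
  apply/seteqP; split => w /= [Uw H]; split => //; first by case.
  by apply: contrapT => pw; apply: H.
by move=> w; rewrite -{1}E => -[].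
Unshelve. all: by end_near.
Qed.

(** * Solving the curvature equations entry by entry *)

(** Certificate form of linear elimination: once the multipliers are supplied, [ring] or [field]
    checks the remaining identity. *)
Lemma eq_of_lincomb3 (K : comPzRingType) (k1 k2 k3 l1 r1 l2 r2 l3 r3 x y : K) :
  l1 = r1 -> l2 = r2 -> l3 = r3 ->
  x - y = k1 * (l1 - r1) + k2 * (l2 - r2) + k3 * (l3 - r3) -> x = y.
Proof.
by move=> -> -> -> /eqP; rewrite !subrr !mulr0 !addr0 subr_eq0 => /eqP.
Qed.

Lemma eq_of_lincomb (K : comPzRingType) (k l r x y : K) :
  l = r -> x - y = k * (l - r) -> x = y.
Proof. by move=> -> /eqP; rewrite subrr mulr0 subr_eq0 => /eqP. Qed.

(* b, c and d stand for the entries of B1, B0 and dA/dt; the hypotheses are the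
   needed entries of the z^2, z and z^0 coefficients of the zero-curvature
   equation, left unsimplified so that they match the matrix products. *)
Lemma curvature_entries_solve (K : numFieldType) (a1 a2 a3 a4 d1 d2 d3 d4 t
    b11 b12 b13 b21 b22 b23 b31 b32 b33
    c11 c12 c13 c21 c22 c23 c31 c32 c33 : K) :
  1 * b12 + 0 * b22 + 0 * b32 = b11 * 0 + b12 * -1 + b13 * 0 ->
  1 * b13 + 0 * b23 + 0 * b33 = b11 * 0 + b12 * 0 + b13 * 0 ->
  0 * b11 + -1 * b21 + 0 * b31 = b21 * 1 + b22 * 0 + b23 * 0 ->
  0 * b13 + -1 * b23 + 0 * b33 = b21 * 0 + b22 * 0 + b23 * 0 ->
  0 * b11 + 0 * b21 + 0 * b31 = b31 * 1 + b32 * 0 + b33 * 0 ->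
  0 * b12 + 0 * b22 + 0 * b32 = b31 * 0 + b32 * -1 + b33 * 0 ->
  0 * b12 + a1 * b22 + 1 * b32 + (1 * c12 + 0 * c22 + 0 * c32) =
    c11 * 0 + c12 * -1 + c13 * 0 + (b11 * a1 + b12 * - t + b13 * a4) ->
  0 * b13 + a1 * b23 + 1 * b33 + (1 * c13 + 0 * c23 + 0 * c33) =
    c11 * 0 + c12 * 0 + c13 * 0 + (b11 * 1 + b12 * a2 + b13 * t) ->
  1 * b11 + - t * b21 + a2 * b31 + (0 * c11 + -1 * c21 + 0 * c31) =
    c21 * 1 + c22 * 0 + c23 * 0 + (b21 * 0 + b22 * 1 + b23 * a3) ->
  1 * b13 + - t * b23 + a2 * b33 + (0 * c13 + -1 * c23 + 0 * c33) =
    c21 * 0 + c22 * 0 + c23 * 0 + (b21 * 1 + b22 * a2 + b23 * t) ->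
  a3 * b11 + a4 * b21 + t * b31 + (0 * c11 + 0 * c21 + 0 * c31) =
    c31 * 1 + c32 * 0 + c33 * 0 + (b31 * 0 + b32 * 1 + b33 * a3) ->
  a3 * b12 + a4 * b22 + t * b32 + (0 * c12 + 0 * c22 + 0 * c32) =
    c31 * 0 + c32 * -1 + c33 * 0 + (b31 * a1 + b32 * - t + b33 * a4) ->
  b11 + (0 * c11 + a1 * c21 + 1 * c31) =
    0 + (c11 * 0 + c12 * 1 + c13 * a3) ->
  b22 + (1 * c12 + - t * c22 + a2 * c32) =
    -1 + (c21 * a1 + c22 * - t + c23 * a4) ->
  b33 + (a3 * c13 + a4 * c23 + t * c33) =
    1 + (c31 * 1 + c32 * a2 + c33 * t) ->
  b12 + (0 * c12 + a1 * c22 + 1 * c32) =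
    d1 + (c11 * a1 + c12 * - t + c13 * a4) ->
  b13 + (0 * c13 + a1 * c23 + 1 * c33) =
    0 + (c11 * 1 + c12 * a2 + c13 * t) ->
  b21 + (1 * c11 + - t * c21 + a2 * c31) =
    0 + (c21 * 0 + c22 * 1 + c23 * a3) ->
  b23 + (1 * c13 + - t * c23 + a2 * c33) =
    d2 + (c21 * 1 + c22 * a2 + c23 * t) ->
  b31 + (a3 * c11 + a4 * c21 + t * c31) =
    d3 + (c31 * 0 + c32 * 1 + c33 * a3) ->
  b32 + (a3 * c12 + a4 * c22 + t * c32) =
    d4 + (c31 * a1 + c32 * - t + c33 * a4) ->
  [/\ d1 = - 3 * a1 * a2 * a3 + 3 * a4,
      d2 = - (3 / 2) * a1 * a2 ^+ 2 + 3 * a2 ^+ 2 * a3 - 9 / 2 * a2 * t - 3 / 2,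
      d3 = 3 / 2 * a1 * a2 * a3 - 3 / 2 * a4
    & d4 = 3 / 2 * a1 * a2 * a4 - 3 * a2 * a3 * a4 + 3 / 2 * a1 * a3
           + 9 / 2 * a4 * t].
Proof.
move=> H12 H13 H21 H23 H31 H32.
(* Bracketing with A1 = diag(1, -1, 0) multiplies entry (i, j) by the difference of the i-th and
   j-th diagonal entries; each [k] is the reciprocal of that difference, here and for the entries of
   B0. *)
have b12E : b12 = 0 by apply: (eq_of_lincomb (k := 1 / 2) H12); field.
have b13E : b13 = 0 by apply: (eq_of_lincomb (k := 1) H13); ring.
have b21E : b21 = 0 by apply: (eq_of_lincomb (k := - 1 / 2) H21); field.
have b23E : b23 = 0 by apply: (eq_of_lincomb (k := - 1) H23); ring.
have b31E : b31 = 0 by apply: (eq_of_lincomb (k := - 1) H31); ring.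
have b32E : b32 = 0 by apply: (eq_of_lincomb (k := 1) H32); ring.
subst b12 b13 b21 b23 b31 b32.
move=> G12 G13 G21 G23 G31 G32.
have c12E : c12 = a1 * (b11 - b22) / 2.
  by apply: (eq_of_lincomb (k := 1 / 2) G12); field.
have c21E : c21 = (b11 - b22) / 2.
  by apply: (eq_of_lincomb (k := - 1 / 2) G21); field.
have c13E : c13 = b11 - b33 by apply: (eq_of_lincomb (k := 1) G13); ring.
have c31E : c31 = a3 * (b11 - b33).
  by apply: (eq_of_lincomb (k := - 1) G31); ring.
have c23E : c23 = a2 * (b33 - b22).
  by apply: (eq_of_lincomb (k := - 1) G23); ring.
have c32E : c32 = a4 * (b33 - b22).
  by apply: (eq_of_lincomb (k := 1) G32); ring.
subst c12 c21 c13 c31 c23 c32.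
move=> E11 E22 E33.
(* Off the diagonal, B0 is A0 with entries (i, j) and (j, i) scaled by the same weight, so [A0, B0]
   has zero diagonal and the diagonal of B1 equals that of dA/dt. *)
have b11E : b11 = 0 by apply: (eq_of_lincomb (k := 1) E11); ring.
have b22E : b22 = -1 by apply: (eq_of_lincomb (k := 1) E22); ring.
have b33E : b33 = 1 by apply: (eq_of_lincomb (k := 1) E33); ring.
subst b11 b22 b33.
(* E13 and E21, the entries where A is constant, determine c33 - c11 and
   c11 - c22, the only combinations of the diagonal of B0 that occur below. *)
move=> E12 E13 E21 E23 E31 E32; split.
(* The multipliers [k2] and [k3] cancel the diagonal entries of B0; a weight 0 fills the third slot
   when two equations suffice. *)
- by apply: (eq_of_lincomb3 (k1 := -1) (k2 := - a1) (k3 := 0) E12 E21 E21);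
    field.
- by apply: (eq_of_lincomb3 (k1 := -1) (k2 := a2) (k3 := a2) E23 E21 E13);
    field.
- by apply: (eq_of_lincomb3 (k1 := -1) (k2 := - a3) (k3 := 0) E31 E13 E21);
    field.
- by apply: (eq_of_lincomb3 (k1 := -1) (k2 := - a4) (k3 := - a4) E32 E21 E13);
    field.
Qed.

(** * From commuting operators to the coefficients of the zero-curvature equation *)

Lemma ord3P (P : 'I_3 -> Prop) : P 0 -> P 1 -> P 2%:R -> forall i, P i.
Proof.
move=> P0 P1 P2; case=> [[|[|[|//]]]] H.
- by rewrite (_ : Ordinal H = 0) //; apply/val_inj.
- by rewrite (_ : Ordinal H = 1) //; apply/val_inj.
- by rewrite (_ : Ordinal H = 2%:R) //; apply/val_inj.
Qed.

Lemma mulmx3E (K : pzRingType) (M N : 'M[K]_3) i j :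
  (M *m N) i j = M i 0 * N 0 j + M i 1 * N 1 j + M i 2%:R * N 2%:R j.
Proof.
rewrite mxE !big_ord_recl big_ord0 addr0 addrA.
by congr (_ * _ + _ * _ + _ * _); congr (_ _ _); apply/val_inj.
Qed.

Lemma mx3E (R : realType) (x00 x01 x02 x10 x11 x12 x20 x21 x22 : C R)
    (M := mx3 [:: [:: x00; x01; x02]; [:: x10; x11; x12]; [:: x20; x21; x22]]) :
  ((M 0 0 = x00) * (M 0 1 = x01) * (M 0 2%:R = x02) *
   (M 1 0 = x10) * (M 1 1 = x11) * (M 1 2%:R = x12) *
   (M 2%:R 0 = x20) * (M 2%:R 1 = x21) * (M 2%:R 2%:R = x22))%type.
Proof. by do !split; rewrite mxE. Qed.

Lemma commute_on_entries (R : realType) (U : set (C R))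
    (A B : C R -> C R -> 'M[C R]_3) :
  commute_on U A B -> forall z t, U t -> forall i j,
  derive1 (fun s => B s t i j) z + (A z t *m B z t) i j =
  derive1 (fun s => A z s i j) t + (B z t *m A z t) i j.
Proof.
move=> cAB z t Ut i j.
pose F (_ _ : C R) : 'cV[C R]_3 := delta_mx j 0.
have anaF k : analytic_on [set x : C R * C R | U x.2] (fun x => F x.1 x.2 k 0).
  by move=> x _; exact: differentiable_cst.
have := cAB F anaF z t Ut.
(* The derivative of the constant e_j vanishes, so each operator returns column j of its matrix. *)
have -> : dt_plus B F = fun z t => col j (B z t).
  apply/funext => x; apply/funext => y; rewrite colE; apply/colP => k.
  by rewrite mxE [X in X + _]mxE derive1_cst add0r.
have -> : dz_plus A F = fun z t => col j (A z t).
  apply/funext => x; apply/funext => y; rewrite colE; apply/colP => k.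
  by rewrite mxE [X in X + _]mxE derive1_cst add0r.
have DZ M N : dz_plus M (fun z t => col j (N z t)) z t i 0 =
    derive1 (fun s => N s t i j) z + (M z t *m N z t) i j.
  rewrite mxE; congr (_ + _).
    by rewrite mxE; congr (derive1 _ z); apply/funext => s; rewrite mxE.
  by rewrite colE mulmxA -colE mxE.
have DT M N : dt_plus M (fun z t => col j (N z t)) z t i 0 =
    derive1 (fun s => N z s i j) t + (M z t *m N z t) i j.
  rewrite mxE; congr (_ + _).
    by rewrite mxE; congr (derive1 _ t); apply/funext => s; rewrite mxE.
  by rewrite colE mulmxA -colE mxE.
by move=> /colP /(_ i); rewrite DZ DT.
Qed.

(** The values at 0, 1 and -1 suffice: the first gives [c0], and the sum of the other two is then 2
    [c2], with 2 invertible. *)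
Lemma quadratic_coefs_eq0 (K : numFieldType) (V : lmodType K) (c0 c1 c2 : V) :
  (forall z : K, c0 + z *: c1 + z ^+ 2 *: c2 = 0) ->
  [/\ c0 = 0, c1 = 0 & c2 = 0].
Proof.
move=> H.
have c00 : c0 = 0 by have := H 0; rewrite expr0n !scale0r !addr0.
have H1 := H 1; have HN := H (-1).
rewrite c00 add0r expr1n !scale1r in H1.
rewrite c00 add0r sqrrN expr1n scaleN1r scale1r in HN.
have c20 : c2 = 0.
  have : c2 *+ 2 = 0.
    by rewrite mulr2n -[RHS]addr0 -[X in _ = X + _]H1 -HN addrACA subrr add0r.
  by rewrite -scaler_nat => /eqP; rewrite scaler_eq0 pnatr_eq0 => /eqP.
by split=> //; rewrite c20 addr0 in H1.
Qed.

Lemma zero_curvature_coefs (K : numFieldType) n (A0 A1 B0 B1 D : 'M[K]_n) :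
  (forall z : K, B1 + (A0 + z *: A1) *m (B0 + z *: B1) =
     D + (B0 + z *: B1) *m (A0 + z *: A1)) ->
  [/\ B1 + A0 *m B0 = D + B0 *m A0,
      A0 *m B1 + A1 *m B0 = B0 *m A1 + B1 *m A0 &
      A1 *m B1 = B1 *m A1].
Proof.
move=> H.
have [z|c0 c1 c2] := @quadratic_coefs_eq0 K 'M[K]_n
  (B1 + A0 *m B0 - (D + B0 *m A0))
  (A0 *m B1 + A1 *m B0 - (B0 *m A1 + B1 *m A0)) (A1 *m B1 - B1 *m A1).
  have := H z; rewrite !mulmxDl !mulmxDr -!scalemxAl -!scalemxAr !scalerA.
  move=> /eqP; rewrite -subr_eq0 => /eqP E; rewrite -[RHS]E.
  apply/matrixP => i j; rewrite !mxE; ring.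
by split; apply/eqP; rewrite -subr_eq0; apply/eqP.
Qed.

Lemma derive1_subl (K : numFieldType) (c x : K) :
  derive1 (fun y => c - y) x = -1.
Proof.
have H : is_derive x 1 (fun y : K => c - y) (-1).
  by apply: is_derive_eq; rewrite sub0r.
by rewrite derive1E derive_val.
Qed.

Lemma connA_zero_curvature (R : realType) (U : set (C R))
    (a1 a2 a3 a4 : C R -> C R) (B0 B1 : C R -> 'M[C R]_3)
    (commAB : commute_on U (connA a1 a2 a3 a4)
                           (fun z t => B0 t + z *: B1 t)) t (Ut : U t)
    (A0 := mx3 [:: [:: 0; a1 t; 1]; [:: 1; - t; a2 t]; [:: a3 t; a4 t; t]])
    (A1 := mx3 [:: [:: 1; 0; 0]; [:: 0; -1; 0]; [:: 0; 0; 0]] : 'M[C R]_3)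
    (D := mx3 [:: [:: 0; derive1 a1 t; 0]; [:: 0; -1; derive1 a2 t];
                  [:: derive1 a3 t; derive1 a4 t; 1]]) :
  [/\ B1 t + A0 *m B0 t = D + B0 t *m A0,
      A0 *m B1 t + A1 *m B0 t = B0 t *m A1 + B1 t *m A0 &
      A1 *m B1 t = B1 t *m A1].
Proof.
apply: zero_curvature_coefs => z.
have AE : connA a1 a2 a3 a4 z t = A0 + z *: A1.
  apply/matrixP => i j; rewrite [RHS]mxE [X in _ + X]mxE.
  move: i j; apply: ord3P; apply: ord3P; rewrite !mx3E; ring.
apply/matrixP => i j; rewrite -AE.
have := commute_on_entries commAB z Ut i j.
have -> : derive1 (fun s => (B0 t + s *: B1 t) i j) z = B1 t i j.
  under eq_fun do rewrite mxE [X in _ + X]mxE.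
  rewrite derive1E deriveD// derive_cst add0r deriveM// derive_id derive_cst.
  by rewrite scaler0 add0r; exact: mulr1.
move=> E; rewrite [LHS]mxE {}E [RHS]mxE; congr (_ + _).
have ext (f g : C R -> C R) : f =1 g -> derive1 f t = derive1 g t.
  by move=> /funext ->.
have cst (c : C R) f : f =1 (fun=> c) -> derive1 f t = 0.
  by move=> /ext ->; exact: derive1_cst.
(* In dA/dt the entries z and 1 give 0, -z-t gives -1, t gives 1, and the other four give the
   derivatives of the a_i. *)
move: i j; apply: ord3P; apply: ord3P; rewrite [RHS]mx3E.
- by apply: (cst z) => s; rewrite mx3E.
- by apply: ext => s; rewrite mx3E.
- by apply: (cst 1) => s; rewrite mx3E.
- by apply: (cst 1) => s; rewrite mx3E.
- rewrite -(derive1_subl (- z) t).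
  by apply: ext => s; rewrite mx3E.
- by apply: ext => s; rewrite mx3E.
- by apply: ext => s; rewrite mx3E.
- by apply: ext => s; rewrite mx3E.
- rewrite (ext _ id) => [|s]; last by rewrite mx3E.
  by rewrite derive1E derive_id.
Qed.

(** * Partial derivatives of the Hamiltonian and derivatives of the first integrals *)

(** The Hamiltonian has degree 3 in [a2] and 2 in [a4], so this formula yields both partial
    derivatives. *)
Lemma derive1_cubic (K : numFieldType) (c3 c2 c1 c0 x : K) :
  derive1 (fun x : K => c3 * x ^+ 3 + c2 * x ^+ 2 + c1 * x + c0) x =
  3 * c3 * x ^+ 2 + 2 * c2 * x + c1.
Proof.
rewrite derive1E.
have H : is_derive x 1 (fun x : K => c3 * x ^+ 3 + c2 * x ^+ 2 + c1 * x + c0)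
    (3 * c3 * x ^+ 2 + 2 * c2 * x + c1).
  by apply: is_derive_eq; rewrite /GRing.scale /=; ring.
by rewrite derive_val.
Qed.

Lemma hamiltonian_fields (R : realType) (p1 p2 x y t : C R) :
  a4_field p1 p2 x y t = dH_da2 p1 p2 x y t /\
  a2_field p1 p2 x y t = - dH_da4 p1 p2 x y t.
Proof.
split; rewrite /dH_da2 /dH_da4.
  have -> : (fun x => hamiltonian p1 p2 x y t) = fun x =>
      - 3 * y ^+ 2 * x ^+ 3 + - ((9 * p1 - 12 * p2) / 2 * y) * x ^+ 2
      + (9 / 2 * y * t - (3 * p1 ^+ 2 - 9 * p1 * p2 + 6 * p2 ^+ 2) / 2) * x
      + 3 / 2 * y.
    by apply/funext => z; rewrite /hamiltonian; field.
  by rewrite derive1_cubic /a4_field; field.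
have -> : hamiltonian p1 p2 x ^~ t = fun y =>
    0 * y ^+ 3 + (- 3 * x ^+ 3) * y ^+ 2
    + (3 / 2 + 9 / 2 * x * t - (9 * p1 - 12 * p2) / 2 * x ^+ 2) * y
    - (3 * p1 ^+ 2 - 9 * p1 * p2 + 6 * p2 ^+ 2) / 2 * x.
  by apply/funext => z; rewrite /hamiltonian; field.
by rewrite derive1_cubic /a2_field; field.
Qed.

Lemma is_derive_p1 (K : numFieldType) (f g : K -> K) (x : K) :
  derivable f x 1 -> derivable g x 1 ->
  is_derive x 1 (fun y => f y + 2 * g y) (derive1 f x + 2 * derive1 g x).
Proof.
move=> /derivableP df /derivableP dg; rewrite !derive1E.
by apply: is_derive_eq; rewrite /GRing.scale /=; ring.
Qed.

Lemma is_derive_p2 (K : numFieldType) (f g h k : K -> K) (x : K) :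
  derivable f x 1 -> derivable g x 1 -> derivable h x 1 -> derivable k x 1 ->
  is_derive x 1 (fun y => f y + g y + h y * k y)
    (derive1 f x + derive1 g x + (derive1 h x * k x + h x * derive1 k x)).
Proof.
move=> /derivableP df /derivableP dg /derivableP dh /derivableP dk.
rewrite !derive1E.
by apply: is_derive_eq; rewrite /GRing.scale /=; ring.
Qed.

(** * The differential equations, their two constants and the Hamiltonian form *)

Theorem mainTheorem7 (R : realType) (U : set (C R)) (a1 a2 a3 a4 : C R -> C R)
    (B0 B1 : C R -> 'M[C R]_3)
    (domU : domain U)
    (ana1 : analytic_on U a1) (ana2 : analytic_on U a2)
    (ana3 : analytic_on U a3) (ana4 : analytic_on U a4)
    (commAB : commute_on U (connA a1 a2 a3 a4)
                           (fun z t => B0 t + z *: B1 t)) :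
  (forall t, U t ->
     [/\ derive1 a1 t = - 3 * a1 t * a2 t * a3 t + 3 * a4 t,
         derive1 a2 t = - (3 / 2) * a1 t * a2 t ^+ 2 + 3 * a2 t ^+ 2 * a3 t
                        - 9 / 2 * a2 t * t - 3 / 2,
         derive1 a3 t = 3 / 2 * a1 t * a2 t * a3 t - 3 / 2 * a4 t
       & derive1 a4 t = 3 / 2 * a1 t * a2 t * a4 t - 3 * a2 t * a3 t * a4 t
                        + 3 / 2 * a1 t * a3 t + 9 / 2 * a4 t * t]) /\
  exists p1 p2 : C R,
    [/\ forall t, U t -> a1 t + 2 * a3 t = p1,
        forall t, U t -> a1 t + a3 t + a2 t * a4 t = p2,
        forall t, U t ->
          derive1 a2 t = a2_field p1 p2 (a2 t) (a4 t) t /\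
          derive1 a4 t = a4_field p1 p2 (a2 t) (a4 t) t,
        forall x y t : C R,
          a4_field p1 p2 x y t = dH_da2 p1 p2 x y t /\
          a2_field p1 p2 x y t = - dH_da4 p1 p2 x y t
      & forall t, U t ->
          derive1 a4 t = dH_da2 p1 p2 (a2 t) (a4 t) t /\
          derive1 a2 t = - dH_da4 p1 p2 (a2 t) (a4 t) t].
Proof.
have ode t : U t ->
     [/\ derive1 a1 t = - 3 * a1 t * a2 t * a3 t + 3 * a4 t,
         derive1 a2 t = - (3 / 2) * a1 t * a2 t ^+ 2 + 3 * a2 t ^+ 2 * a3 t
                        - 9 / 2 * a2 t * t - 3 / 2,
         derive1 a3 t = 3 / 2 * a1 t * a2 t * a3 t - 3 / 2 * a4 t
       & derive1 a4 t = 3 / 2 * a1 t * a2 t * a4 t - 3 * a2 t * a3 t * a4 t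
                        + 3 / 2 * a1 t * a3 t + 9 / 2 * a4 t * t].
  move=> Ut; have [/matrixP H0 /matrixP H1 /matrixP H2] :=
    connA_zero_curvature commAB Ut.
  apply: (@curvature_entries_solve (C R) _ _ _ _ _ _ _ _ _
    (B1 t 0 0) (B1 t 0 1) (B1 t 0 2%:R) (B1 t 1 0) (B1 t 1 1) (B1 t 1 2%:R)
    (B1 t 2%:R 0) (B1 t 2%:R 1) (B1 t 2%:R 2%:R)
    (B0 t 0 0) (B0 t 0 1) (B0 t 0 2%:R) (B0 t 1 0) (B0 t 1 1) (B0 t 1 2%:R)
    (B0 t 2%:R 0) (B0 t 2%:R 1) (B0 t 2%:R 2%:R)).
  (* Off-diagonal entries of the z^2 and z coefficients, then all nine entries of the z^0
     coefficient, diagonal first. *)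
  - by have := H2 0 1; rewrite !mulmx3E !mx3E.
  - by have := H2 0 2%:R; rewrite !mulmx3E !mx3E.
  - by have := H2 1 0; rewrite !mulmx3E !mx3E.
  - by have := H2 1 2%:R; rewrite !mulmx3E !mx3E.
  - by have := H2 2%:R 0; rewrite !mulmx3E !mx3E.
  - by have := H2 2%:R 1; rewrite !mulmx3E !mx3E.
  - by have := H1 0 1; rewrite mxE [RHS]mxE !mulmx3E !mx3E.
  - by have := H1 0 2%:R; rewrite mxE [RHS]mxE !mulmx3E !mx3E.
  - by have := H1 1 0; rewrite mxE [RHS]mxE !mulmx3E !mx3E.
  - by have := H1 1 2%:R; rewrite mxE [RHS]mxE !mulmx3E !mx3E.
  - by have := H1 2%:R 0; rewrite mxE [RHS]mxE !mulmx3E !mx3E.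
  - by have := H1 2%:R 1; rewrite mxE [RHS]mxE !mulmx3E !mx3E.
  - by have := H0 0 0; rewrite mxE [RHS]mxE !mulmx3E !mx3E.
  - by have := H0 1 1; rewrite mxE [RHS]mxE !mulmx3E !mx3E.
  - by have := H0 2%:R 2%:R; rewrite mxE [RHS]mxE !mulmx3E !mx3E.
  - by have := H0 0 1; rewrite mxE [RHS]mxE !mulmx3E !mx3E.
  - by have := H0 0 2%:R; rewrite mxE [RHS]mxE !mulmx3E !mx3E.
  - by have := H0 1 0; rewrite mxE [RHS]mxE !mulmx3E !mx3E.
  - by have := H0 1 2%:R; rewrite mxE [RHS]mxE !mulmx3E !mx3E.
  - by have := H0 2%:R 0; rewrite mxE [RHS]mxE !mulmx3E !mx3E.
  - by have := H0 2%:R 1; rewrite mxE [RHS]mxE !mulmx3E !mx3E.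
split=> //.
have der (f : C R -> C R) : analytic_on U f -> forall t, U t -> derivable f t 1.
  by move=> anf t /anf; exact: diff_derivable.
have dp1 t (Ut : U t) := is_derive_p1 (der _ ana1 t Ut) (der _ ana3 t Ut).
have dp2 t (Ut : U t) := is_derive_p2 (der _ ana1 t Ut) (der _ ana3 t Ut)
  (der _ ana2 t Ut) (der _ ana4 t Ut).
(* After substitution of the four equations, the derivatives of both expressions cancel
   identically. *)
have [p1 p1E] : exists p1, forall t, U t -> a1 t + 2 * a3 t = p1.
  apply: derive1_0_domain_const domU _ _ => t Ut; have [d dE] := dp1 t Ut => //.
  by rewrite derive1E dE; have [-> _ -> _] := ode t Ut; field.
have [p2 p2E] : exists p2, forall t, U t -> a1 t + a3 t + a2 t * a4 t = p2.
  apply: derive1_0_domain_const domU _ _ => t Ut; have [d dE] := dp2 t Ut => //.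
  by rewrite derive1E dE; have [-> -> -> ->] := ode t Ut; field.
have fieldE t : U t -> derive1 a2 t = a2_field p1 p2 (a2 t) (a4 t) t /\
    derive1 a4 t = a4_field p1 p2 (a2 t) (a4 t) t.
  move=> Ut; have [_ -> _ ->] := ode t Ut.
  (* Instead of solving for [a1] and [a3], [p1] and [p2] are expanded in the a_i, which turns the
     elimination into an identity for [field]. *)
  rewrite -(p1E t Ut) -(p2E t Ut) /a2_field /a4_field.
  by split; field.
exists p1, p2; split.
- exact: p1E.
- exact: p2E.
- exact: fieldE.
- by move=> x y t; exact: hamiltonian_fields.
move=> t Ut; have [<- <-] := hamiltonian_fields p1 p2 (a2 t) (a4 t) t.
by have [-> ->] := fieldE t Ut.
Qed.
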